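(* Let $(L,\mu,\delta)$ be an InvDer associative algebra over $\mathbb{K}$. Then $(L,[\cdot,\cdot]_C,\delta)$ is an InvDer-Lie algebra, where $[x,y]_C=\mu(x,y)-\mu(y,x)$ for all $x,y\in L$.
   Context: $\mathbb{K}$ is a field of characteristic $0$. A derivation of an algebra $(L,\mu)$ is a linear map $d:L\to L$ with $d(\mu(x,y))=\mu(dx,y)+\mu(x,dy)$ for all $x,y$. $\mathrm{InvDer}(L)$ denotes the set of invertible derivations $\delta$ of the algebra $L$ such that $\delta^{-1}$ is also a derivation. An InvDer associative algebra $(L,\mu,\delta)$ is an associative algebra $(L,\mu)$ (not assumed unital) equipped with $\delta\in\mathrm{InvDer}(L)$ satisfying $\mu(\delta x,\mu(y,z))=\mu(\mu(x,y),\delta z)$ for all $x,y,z\in L$. An InvDer-Lie algebra $(L,[\cdot,\cdot],\delta)$ is a Lie algebra $(L,[\cdot,\cdot])$ equipped with $\delta\in\mathrm{InvDer}(L)$ satisfying $[\delta x,[y,z]]+[\delta y,[z,x]]+[\delta z,[x,y]]=0$ for all $x,y,z\in L$. *)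

(* Defs.v *)
From mathcomp Require Import all_boot all_algebra.

Set Implicit Arguments.
Unset Strict Implicit.
Unset Printing Implicit Defensive.

Import GRing.Theory.
Local Open Scope ring_scope.

Section InvDer.
Variables (K : fieldType) (L : lmodType K).
Implicit Types (mu br : L -> L -> L) (d delta : L -> L).

Definition is_assoc_algebra mu : Prop := bilinear_for *:%R *:%R mu /\ associative mu.

Definition is_Lie_algebra br : Prop :=
  [/\ bilinear_for *:%R *:%R br,
      forall x, br x x = 0
    & forall x y z, br x (br y z) + br y (br z x) + br z (br x y) = 0].

Definition is_derivation mu d : Prop :=
  linear d /\ forall x y, d (mu x y) = mu (d x) y + mu x (d y).

Definition InvDer mu delta : Prop :=
  is_derivation mu delta /\
  exists delta_inv : L -> L,
    [/\ cancel delta delta_inv, cancel delta_inv delta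
      & is_derivation mu delta_inv].

Definition is_InvDer_assoc_algebra mu delta : Prop :=
  [/\ is_assoc_algebra mu, InvDer mu delta
    & forall x y z, mu (delta x) (mu y z) = mu (mu x y) (delta z)].

Definition is_InvDer_Lie_algebra br delta : Prop :=
  [/\ is_Lie_algebra br, InvDer br delta
    & forall x y z,
        br (delta x) (br y z) + br (delta y) (br z x)
          + br (delta z) (br x y) = 0].

Definition commutator mu (x y : L) : L := mu x y - mu y x.

End InvDer.

(* Main.v *)
Require Import Defs.
From mathcomp Require Import all_boot all_algebra.

(** The Lie side of the statement is the antisymmetrization of the associative
    side. A derivation of [mu] is additive, hence also a derivation of the
    commutator; applied to [delta] and to its inverse this transports InvDer.

    The Jacobi identity and its [delta]-twisted form are one and the same fact,
    [commutator_cyclic_sum]: for a bilinear [mu] and any map [f] with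
    [f x (y z) = (x y) (f z)], the cyclic sum of [[f x, [y, z]]] vanishes.
    Taking [f] to be the identity, the hypothesis is associativity and the
    conclusion is the Jacobi identity; taking [f] to be [delta], it is the
    compatibility condition of an InvDer associative algebra and the conclusion
    is that of an InvDer-Lie algebra. *)

Import GRing.Theory.
Local Open Scope ring_scope.

Section Commutator.
Variables (K : fieldType) (L : lmodType K) (mu : L -> L -> L).

Lemma commutator_bilinear :
  bilinear_for *:%R *:%R mu -> bilinear_for *:%R *:%R (commutator mu).
Proof.
case=> mu_l mu_r; split=> u a x y; rewrite /commutator /=.
  by rewrite (mu_l u a x y) (mu_r u a x y) /= scalerBr opprD addrACA.
by rewrite (mu_l u a x y) (mu_r u a x y) /= scalerBr opprD addrACA.
Qed.

Lemma commutator_derivation d :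
  is_derivation mu d -> is_derivation (commutator mu) d.
Proof.
case=> d_linear d_mu; split=> // x y; rewrite /commutator.
by rewrite (GRing.zmod_morphism_linear d_linear) !d_mu [mu (d y) x + _]addrC opprD addrACA.
Qed.

Lemma commutator_InvDer delta :
  InvDer mu delta -> InvDer (commutator mu) delta.
Proof.
case=> der_delta [delta_inv [deltaK delta_invK der_inv]].
split; first exact: commutator_derivation.
by exists delta_inv; split=> //; exact: commutator_derivation.
Qed.

(** Fully expanded, the cyclic sum has one term of sign [+] and one of sign [-]
    for each of the six orderings of [x], [y], [z]: [f u (v w)] and
    [(u v) (f w)] occur with opposite signs, and the hypothesis equates them. *)
Lemma commutator_cyclic_sum (f : L -> L) :
  bilinear_for *:%R *:%R mu ->
  (forall x y z, mu (f x) (mu y z) = mu (mu x y) (f z)) ->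
  forall x y z,
    commutator mu (f x) (commutator mu y z)
      + commutator mu (f y) (commutator mu z x)
      + commutator mu (f z) (commutator mu x y) = 0.
Proof.
move=> -[mu_l mu_r] f_mu x y z; rewrite /commutator.
have muBl u v w : mu (u - v) w = mu u w - mu v w.
  exact: (GRing.zmod_morphism_linear (mu_l w) u v).
have muBr u v w : mu u (v - w) = mu u v - mu u w.
  exact: (GRing.zmod_morphism_linear (mu_r u) v w).
have expand u v w : mu (f u) (mu v w - mu w v) - mu (mu v w - mu w v) (f u)
    = (mu (mu u v) (f w) - mu (mu v w) (f u))
      - (mu (mu u w) (f v) - mu (mu w v) (f u)).
  by rewrite muBl muBr !f_mu !opprD addrACA.
rewrite !expand.
(* Separate the first differences from the second ones: each of the two sums
   telescopes along the cycle, in opposite directions. *)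
rewrite [X in X + _ = 0]addrACA -opprD addrACA -opprD.
set p := mu (mu x y) _; set q := mu (mu y z) _; set r := mu (mu z x) _.
set p' := mu (mu x z) _; set q' := mu (mu z y) _; set r' := mu (mu y x) _.
have -> : p - q + (q - r) + (r - p) = 0 by rewrite subrKA subrKA subrr.
have -> : p' - q' + (r' - p') + (q' - r') = 0.
  by rewrite [p' - q' + _]addrC subrKA subrKA subrr.
by rewrite subr0.
Qed.

End Commutator.

Theorem proposition3p7 (K : fieldType) (charK0 : [pchar K] =i pred0)
    (L : lmodType K) (mu : L -> L -> L) (delta : L -> L)
    (hL : is_InvDer_assoc_algebra mu delta) :
  is_InvDer_Lie_algebra (commutator mu) delta.
Proof.
case: hL => -[mu_bilinear mu_assoc] delta_InvDer delta_mu; split.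
- split; first exact: commutator_bilinear.
    by move=> x; rewrite /commutator subrr.
  exact: (@commutator_cyclic_sum _ _ mu id).
- exact: commutator_InvDer.
- exact: commutator_cyclic_sum.
Qed.
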